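(* Let $m\ge1$, $N\ge 2$, and let $\{\mathbb{R}^m;h_1,\dots,h_N\}$ be an iterated function system of similarity transformations $h_i(x)=c_iU_ix+a_i$, where $0<c_i<1$, $U_i$ is an $m\times m$ orthogonal matrix and $a_i\in\mathbb{R}^m$ ($i=1,\dots,N$). Then there exists a constant $k_*\in\mathbb{R}$ such that $\Delta_n^*\le k_*\Delta_n$ for all $n\in\mathbb{N}$.
   Context: For $i=i_1i_2\dots i_n\in\{1,\dots,N\}^n$ put $h_i=h_{i_1}\circ h_{i_2}\circ\cdots\circ h_{i_n}$. The attractor $A$ is the unique nonempty compact set with $A=\bigcup_{i=1}^N h_i(A)$, and $\mathrm{co}(A)$ is its closed convex hull. For similarities $\Phi(x)=s\mathcal{O}x+d$ and $\Phi_*(x)=s_*\mathcal{O}_*x+d_*$ ($s,s_*\in(0,1)$, $\mathcal{O},\mathcal{O}_*$ orthogonal, $d,d_*\in\mathbb{R}^m$), set $d(\Phi,\Phi_* )=|\log s-\log s_*|+\|\mathcal{O}-\mathcal{O}_*\|+\|d-d_*\|_2$, with $\|\cdot\|$ the operator norm and $\|\cdot\|_2$ the Euclidean norm. Define $$\Delta_n=\inf\{d(h_i,h_j): i,j\in\{1,\dots,N\}^n,\ i\ne j\},$$ $$\Delta_n^*=\inf\{\mathfrak{H}(h_i(\mathrm{co}(A)),h_j(\mathrm{co}(A))): i,j\in\{1,\dots,N\}^n,\ i\neq j\},$$ where $\mathfrak{H}$ is the Hausdorff distance between nonempty compact subsets of $\mathbb{R}^m$ with respect to the Euclidean norm. 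*)

(* Defs.v *)
From HB Require Import structures.
From mathcomp Require Import all_boot all_order all_algebra.
From mathcomp Require Import all_classical all_reals all_analysis.

Set Implicit Arguments.
Unset Strict Implicit.
Unset Printing Implicit Defensive.

Import Order.TTheory GRing.Theory Num.Theory.
Import numFieldNormedType.Exports.

Local Open Scope classical_set_scope.
Local Open Scope ring_scope.

(* The library's norm on matrices is the sup norm, so the Euclidean norm and
   the distances built on it are defined here. The library topology on
   'cV[R]_m (used for [compact] and [closed]) is the usual one on R^m.
   [sup] and [inf] are real-valued, with value 0 on the empty set. *)

Section Euclidean.
Variables (R : realType) (m : nat).

Definition enorm (x : 'cV[R]_m) : R := Num.sqrt (\sum_(i < m) x i 0 ^+ 2).

Definition opnorm (M : 'M[R]_m) : R :=
  sup [set enorm (M *m x) | x in [set x | enorm x <= 1]].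

Definition orthogonal_mx (U : 'M[R]_m) : Prop := U *m U^T = 1%:M.

Definition dist_set (x : 'cV[R]_m) (B : set 'cV[R]_m) : R :=
  inf [set enorm (x - y) | y in B].

Definition hausdorff_dist (A B : set 'cV[R]_m) : R :=
  Num.max (sup [set dist_set x B | x in A]) (sup [set dist_set y A | y in B]).

Definition closed_convex_hull (A : set 'cV[R]_m) : set 'cV[R]_m :=
  smallest [set B : set 'cV[R]_m | closed B /\ @convex_set R 'cV[R]_m B] A.

End Euclidean.

(* A map x |-> s O x + d is carried by its data (s, O, d). When s > 0, O is
   orthogonal and m > 0, the map determines the data ([sim_map_inj] below). *)
Record sim (R : realType) (m : nat) := Sim {
  ratio : R;
  rotation : 'M[R]_m;
  translation : 'cV[R]_m }.

Section Similarities.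
Variables (R : realType) (m : nat).
Implicit Types s t : sim R m.

Definition sim_map s (x : 'cV[R]_m) : 'cV[R]_m :=
  ratio s *: (rotation s *m x) + translation s.

Definition sim_id : sim R m := Sim 1 1%:M 0.

Definition sim_comp s t : sim R m :=
  Sim (ratio s * ratio t) (rotation s *m rotation t)
      (sim_map s (translation t)).

Lemma sim_id_map : sim_map sim_id =1 id.
Proof. by move=> x; rewrite /sim_map /= mul1mx scale1r addr0. Qed.

Lemma sim_comp_map s t : sim_map (sim_comp s t) =1 sim_map s \o sim_map t.
Proof.
move=> x; rewrite /sim_map /= mulmxDr -scalemxAr mulmxA.
by rewrite !scalerDr scalerA addrA.
Qed.

Lemma sim_map_inj s t : (0 < m)%N -> 0 < ratio s -> 0 < ratio t ->
  orthogonal_mx (rotation s) -> orthogonal_mx (rotation t) ->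
  sim_map s =1 sim_map t -> s = t.
Proof.
case: s t => [s O d] [s' O' d'] /= m_gt0 s0 s'0 hO hO' e.
have ed : d = d' by have := e 0; rewrite /sim_map /= !mulmx0 !scaler0 !add0r.
have eM : s *: O = s' *: O'.
  apply/matrixP => i j; have := e (delta_mx j 0).
  rewrite /sim_map /= ed => /addIr; rewrite -!colE => /matrixP /(_ i 0).
  by rewrite !mxE.
have es : s = s'.
  have : (s *: O) *m (s *: O)^T = (s' *: O') *m (s' *: O')^T by rewrite eM.
  rewrite !linearZ /= -!scalemxAl hO hO' !scalerA.
  move=> /matrixP /(_ (Ordinal m_gt0) (Ordinal m_gt0)).
  rewrite !mxE eqxx !mulr1n !mulr1 -!expr2 => /eqP.
  by rewrite eqrXn2 ?ltW// => /eqP.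
rewrite -es in eM *; rewrite ed; congr Sim.
by apply: (scalerI _ eM); rewrite gt_eqF.
Qed.

Definition sim_dist s t : R :=
  `|ln (ratio s) - ln (ratio t)| + opnorm (rotation s - rotation t)
  + enorm (translation s - translation t).

End Similarities.

Section IFS.
Variables (R : realType) (m N : nat) (h : 'I_N -> sim R m).

Definition sim_word (w : seq 'I_N) : sim R m :=
  foldr (fun i s => sim_comp (h i) s) (sim_id R m) w.

Lemma sim_word_map (w : seq 'I_N) :
  sim_map (sim_word w) =1 foldr (fun i f => sim_map (h i) \o f) id w.
Proof.
elim: w => [|i w IHw] x /=; first exact: sim_id_map.
by rewrite sim_comp_map /= IHw.
Qed.

Definition is_attractor (A : set 'cV[R]_m) : Prop :=
  [/\ A !=set0, compact A & A = \bigcup_(i in [set: 'I_N]) (sim_map (h i) @` A)].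

(* For N >= 2 and n >= 1 both infima below are over nonempty sets; for n = 0
   there is no pair of distinct words and both are 0 by convention. *)
Definition Delta (n : nat) : R :=
  inf [set sim_dist (sim_word ij.1) (sim_word ij.2)
      | ij in [set ij : n.-tuple 'I_N * n.-tuple 'I_N | ij.1 != ij.2]].

Definition Delta_star (A : set 'cV[R]_m) (n : nat) : R :=
  inf [set hausdorff_dist (sim_map (sim_word ij.1) @` closed_convex_hull A)
                          (sim_map (sim_word ij.2) @` closed_convex_hull A)
      | ij in [set ij : n.-tuple 'I_N * n.-tuple 'I_N | ij.1 != ij.2]].

End IFS.

(* Main.v *)
(* For s, t in (0, 1] we have |s - t| <= |log s - log t|, so two similarities f
   and g of ratio at most 1 differ on the Euclidean ball of radius r by at most
   r |s - t| + r ||O - O'|| + |d - d'| <= (r + 1) d(f, g). Moving each point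
   f(x) to g(x) then bounds the Hausdorff distance between the images of co(A),
   which is contained in such a ball, so k = r + 1 works for all words at once. *)
Require Import Defs.
From HB Require Import structures.
From mathcomp Require Import all_boot all_order all_algebra.
From mathcomp Require Import all_classical all_reals all_analysis.
From mathcomp Require Import ring lra.

Set Implicit Arguments.
Unset Strict Implicit.
Unset Printing Implicit Defensive.

Import Order.TTheory GRing.Theory Num.Theory.
Import numFieldNormedType.Exports.

Local Open Scope classical_set_scope.
Local Open Scope ring_scope.

(** * Euclidean and operator norms *)

Section EuclideanNorm.
Variables (R : realType) (m : nat).
Implicit Types (x y : 'cV[R]_m) (M U : 'M[R]_m).

Lemma enorm_ge0 x : 0 <= enorm x.
Proof. exact: sqrtr_ge0. Qed.

Lemma sqr_enorm x : enorm x ^+ 2 = \sum_(i < m) x i 0 ^+ 2.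
Proof. by rewrite sqr_sqrtr// sumr_ge0// => i _; exact: sqr_ge0. Qed.

Lemma enorm0 : enorm (0 : 'cV[R]_m) = 0.
Proof.
by rewrite /enorm big1 ?sqrtr0// => i _; rewrite mxE expr0n.
Qed.

Lemma enormZ (k : R) x : enorm (k *: x) = `|k| * enorm x.
Proof.
rewrite /enorm -sqrtr_sqr -sqrtrM ?sqr_ge0//; congr Num.sqrt.
by rewrite mulr_sumr; apply: eq_bigr => i _; rewrite mxE exprMn.
Qed.

Lemma enormN x : enorm (- x) = enorm x.
Proof. by rewrite -scaleN1r enormZ normrN1 mul1r. Qed.

Lemma le_coord_enorm x (i : 'I_m) : `|x i 0| <= enorm x.
Proof.
rewrite -sqrtr_sqr ler_wsqrtr// (bigD1 i)//= lerDl.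
by rewrite sumr_ge0// => j _; exact: sqr_ge0.
Qed.

Lemma enorm_eq0 x : enorm x = 0 -> x = 0.
Proof.
move=> x0; apply/matrixP => i j; rewrite ord1 mxE; apply/eqP.
by rewrite -normr_le0 -x0 le_coord_enorm.
Qed.

(** Cauchy-Schwarz, the source of the triangle inequality: for nonzero vectors, expand
    [0 <= \sum_i (|y| x_i - |x| y_i)^2] and cancel [2 |x| |y|]. *)
Lemma dot_le_enorm x y :
  \sum_(i < m) x i 0 * y i 0 <= enorm x * enorm y.
Proof.
have [/enorm_eq0 ->|x0] := eqVneq (enorm x) 0.
  by rewrite enorm0 mul0r big1// => i _; rewrite mxE mul0r.
have [/enorm_eq0 ->|y0] := eqVneq (enorm y) 0.
  by rewrite enorm0 mulr0 big1// => i _; rewrite mxE mulr0.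
have xy0 : 0 < enorm x * enorm y.
  by rewrite mulr_gt0// lt_neqAle eq_sym enorm_ge0 ?x0 ?y0.
rewrite -subr_ge0 -(pmulr_rge0 _ xy0) -(pmulr_rge0 _ (ltr0Sn R 1)).
have : 0 <= \sum_(i < m) (enorm y * x i 0 - enorm x * y i 0) ^+ 2.
  by rewrite sumr_ge0// => i _; exact: sqr_ge0.
congr (_ <= _).
under eq_bigr => i _ do rewrite sqrrB !exprMn.
rewrite big_split sumrB /= -!mulr_sumr -!sqr_enorm -mulr_natl.
rewrite (_ : \sum_(i < m) _ = 2%:R * (enorm x * enorm y
    * \sum_(i < m) x i 0 * y i 0)); first by ring.
by rewrite !mulr_sumr; apply: eq_bigr => i _; ring.
Qed.

Lemma enormD x y : enorm (x + y) <= enorm x + enorm y.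
Proof.
rewrite -ler_sqr ?nnegrE ?addr_ge0 ?enorm_ge0// sqrrD !sqr_enorm.
under eq_bigr => i _ do rewrite mxE sqrrD.
rewrite !big_split /= lerD2r lerD2l -mulr2n lerMn2r/=.
exact: dot_le_enorm.
Qed.

Lemma enorm_orthogonal U x : orthogonal_mx U -> enorm (U *m x) = enorm x.
Proof.
(* The hypothesis is [U *m U^T = 1], but [|U x|^2 = x^T U^T U x] needs the product in the other
   order. *)
move=> /mulmx1C UTU; congr Num.sqrt.
have dotE y : \sum_(i < m) y i 0 ^+ 2 = (y^T *m y) 0 0.
  by rewrite mxE; apply: eq_bigr => i _; rewrite mxE expr2.
by rewrite !dotE trmx_mul mulmxA -(mulmxA _ U^T) UTU mulmx1.
Qed.

(** An unbounded set would have [sup] 0, so [opnorm] dominates its set only once this is known.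
    Coordinates of [x] are at most 1 in absolute value, so absolute row sums bound those of
    [M *m x]. *)
Lemma has_ubound_opnorm M :
  has_ubound [set enorm (M *m x) | x in [set x | enorm x <= 1]].
Proof.
exists (Num.sqrt (\sum_(i < m) (\sum_(j < m) `|M i j|) ^+ 2)) => _ [x x1 <-].
rewrite ler_wsqrtr// ler_sum// => i _.
rewrite -[leLHS]real_normK ?num_real// ler_sqr ?nnegrE ?sumr_ge0// mxE.
apply: le_trans (ler_norm_sum _ _ _) _; apply: ler_sum => j _.
by rewrite normrM ler_piMr// (le_trans (le_coord_enorm _ _)).
Qed.

Lemma opnorm_ge0 M : 0 <= opnorm M.
Proof.
apply: ub_le_sup; first exact: has_ubound_opnorm.
by exists 0; rewrite ?mulmx0 ?enorm0 //= enorm0.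
Qed.

Lemma enorm_mulmx M x : enorm (M *m x) <= opnorm M * enorm x.
Proof.
have [/enorm_eq0 ->|x0] := eqVneq (enorm x) 0.
  by rewrite mulmx0 enorm0 mulr0.
have {}x0 : 0 < enorm x by rewrite lt_neqAle eq_sym x0 enorm_ge0.
rewrite -ler_pdivrMr//.
apply: ub_le_sup; first exact: has_ubound_opnorm.
exists ((enorm x)^-1 *: x);
  rewrite /= -?scalemxAr enormZ ger0_norm ?invr_ge0 ?enorm_ge0//.
  by rewrite mulVf ?gt_eqF.
by rewrite mulrC.
Qed.

(** Transfers bounds obtained from compactness, which concern the sup norm, to the Euclidean
    norm. *)
Lemma enorm_le_mx_norm x : enorm x <= Num.sqrt m%:R * `|x|.
Proof.
rewrite -[`|x|]ger0_norm// -sqrtr_sqr -sqrtrM// ler_wsqrtr//.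
rewrite mulr_natl -[X in _ *+ X]card_ord -sumr_const ler_sum// => i _.
rewrite -[leLHS]real_normK ?num_real// ler_sqr ?nnegrE//.
rewrite [leRHS]/Num.norm/= mx_normrE.
exact: (le_bigmax _ (fun ij => `|x ij.1 ij.2|) (i, 0)).
Qed.

End EuclideanNorm.

(** * Hausdorff distance and closed convex hulls *)

Section HausdorffDistance.
Variables (R : realType) (m : nat).
Implicit Types (A B : set 'cV[R]_m).

Lemma has_lbound_enorm x B : has_lbound [set enorm (x - y) | y in B].
Proof. by exists 0 => _ [y _ <-]; exact: enorm_ge0. Qed.

Lemma dist_set_ge0 x B : 0 <= dist_set x B.
Proof.
have [->|B0] := eqVneq B set0; first by rewrite /dist_set image_set0 inf0.
apply: lb_le_inf; first by apply/image_nonempty/set0P.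
by move=> _ [y _ <-]; exact: enorm_ge0.
Qed.

Lemma sup_dist_set_ge0 A B : 0 <= sup [set dist_set x B | x in A].
Proof.
(* If the set is empty or unbounded, [sup] takes its default value 0. *)
have [[[d Ad] ubA]|noA] := pselect (has_sup [set dist_set x B | x in A]).
  apply: le_trans (ub_le_sup ubA Ad).
  by case: Ad => x _ <-; exact: dist_set_ge0.
by rewrite sup_out.
Qed.

Lemma hausdorff_dist_ge0 A B : 0 <= hausdorff_dist A B.
Proof. by rewrite le_max sup_dist_set_ge0. Qed.

Lemma hausdorff_dist_image_le (f g : 'cV[R]_m -> 'cV[R]_m) A r :
  A !=set0 -> (forall x, A x -> enorm (f x - g x) <= r) ->
  hausdorff_dist (f @` A) (g @` A) <= r.
Proof.
(* One of the two suprema; exchanging the maps gives the other. The point [g' x] is a competitor in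
   the infimum for [f' x]. *)
have half (f' g' : 'cV[R]_m -> 'cV[R]_m) :
    A !=set0 -> (forall x, A x -> enorm (f' x - g' x) <= r) ->
    sup [set dist_set x (g' @` A) | x in f' @` A] <= r.
  move=> A0 fg; apply: ge_sup; first exact/image_nonempty/image_nonempty.
  move=> _ [_ [x Ax <-] <-]; apply: le_trans (fg x Ax).
  by apply: ge_inf; [exact: has_lbound_enorm|exists (g' x) => //; exists x].
move=> A0 fg; rewrite ge_max !half// => x Ax.
by rewrite -opprB enormN fg.
Qed.

(** Makes the sup-norm ball a candidate in the definition of [closed_convex_hull], so any such ball
    containing [A] contains its hull. *)
Lemma convex_closed_mx_ball r :
  closed [set x : 'cV[R]_m | `|x| <= r] /\
  @convex_set R 'cV[R]_m [set x : 'cV[R]_m | `|x| <= r].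
Proof.
split.
  apply: (@preimage_closed _ _ (fun x : 'cV[R]_m => `|x|) [set t | t <= r]).
    by move=> x _; exact: norm_continuous.
  exact: closed_le.
move=> x y t; rewrite !inE /= => xr yr.
have t0 : 0 <= t%:num by [].
have t1 : 0 <= 1 - t%:num by rewrite subr_ge0.
apply: le_trans (ler_normD _ _) _; rewrite !normrZ !ger0_norm//.
rewrite [leRHS](_ : r = t%:num * r + (1 - t%:num) * r); last by ring.
by rewrite lerD// ler_wpM2l.
Qed.

Lemma closed_convex_hull_bounded A : compact A ->
  exists2 r, 0 <= r & forall x, closed_convex_hull A x -> enorm x <= r.
Proof.
move=> /compact_bounded /pinfty_ex_gt0 [M M0 AM].
exists (Num.sqrt m%:R * M); first by rewrite mulr_ge0// ltW.
move=> x coAx; apply: le_trans (enorm_le_mx_norm x) _.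
rewrite ler_wpM2l//.
by have := smallest_sub (convex_closed_mx_ball M) AM coAx.
Qed.

End HausdorffDistance.

(** For [t <= s], put [u = ln t - ln s]. Then [t = s * expR u >= s * (1 + u)], so
    [s - t <= s * (- u) <= - u], as [s <= 1] and [u <= 0]. *)
Lemma dist_le_dist_ln (R : realType) (s t : R) :
  0 < s <= 1 -> 0 < t <= 1 -> `|s - t| <= `|ln s - ln t|.
Proof.
wlog st : s t / t <= s.
  move=> H s1 t1; have [/H->//|/ltW/H] := leP t s.
  by rewrite distrC (distrC (ln s)); apply.
move=> /andP[s0 s1] /andP[t0 _].
rewrite ger0_norm ?subr_ge0//.
apply: le_trans (ler_norm _).
have lts : 0 <= ln s - ln t by rewrite subr_ge0 ler_ln.
have tE : t = s * expR (ln t - ln s).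
  by rewrite expRB !lnK ?posrE// mulrCA divff ?mulr1// gt_eqF.
have := ler_wpM2l (ltW s0) (expR_ge1Dx (ln t - ln s)).
rewrite -tE => tge.
nra.
Qed.

(** * Similarities of ratio at most 1 *)

Section Contractions.
Variables (R : realType) (m : nat).
Implicit Types s t : sim R m.

(* [ratio] alone would denote the type of fractions of [fraction.v]. *)
Definition nonexpansive s :=
  0 < Defs.ratio s <= 1 /\ orthogonal_mx (rotation s).

(** Allowing ratio 1 lets the empty word start the induction over words. *)
Lemma nonexpansive_id : nonexpansive (sim_id R m).
Proof. by split; rewrite /= ?ltr01 ?lexx// /orthogonal_mx trmx1 mulmx1. Qed.

Lemma nonexpansive_comp s t :
  nonexpansive s -> nonexpansive t -> nonexpansive (sim_comp s t).
Proof.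
move=> [/andP[s0 s1] sU] [/andP[t0 t1] tU]; split => /=.
  by rewrite mulr_gt0//= mulr_ile1// ltW.
by rewrite /orthogonal_mx trmx_mul mulmxA -(mulmxA (rotation s)) tU mulmx1.
Qed.

Lemma nonexpansive_word (N : nat) (h : 'I_N -> sim R m) (w : seq 'I_N) :
  (forall i, nonexpansive (h i)) -> nonexpansive (sim_word h w).
Proof.
move=> hh; elim: w => [|i w IHw]; first exact: nonexpansive_id.
exact: nonexpansive_comp.
Qed.

Lemma enorm_sim_map_sub_le s t x r : nonexpansive s -> nonexpansive t ->
  enorm x <= r ->
  enorm (sim_map s x - sim_map t x) <= (r + 1) * sim_dist s t.
Proof.
move=> [s01 sU] [t01 tU] xr.
have r0 : 0 <= r := le_trans (enorm_ge0 x) xr.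
have /andP[t0 t1] := t01.
(* Inserting the ratio of [t] times the rotated [x] of [s] isolates the change of ratio, of rotation
   and of translation. *)
have -> : sim_map s x - sim_map t x =
    (Defs.ratio s - Defs.ratio t) *: (rotation s *m x)
    + Defs.ratio t *: ((rotation s - rotation t) *m x)
    + (translation s - translation t).
  rewrite /sim_map mulmxBl scalerBr scalerBl opprD addrACA.
  by congr (_ + _); rewrite addrA subrK.
apply: le_trans (enormD _ _) _.
apply: le_trans (lerD (enormD _ _) (lexx _)) _.
rewrite !enormZ enorm_orthogonal// (gtr0_norm t0).
have h1 : `|Defs.ratio s - Defs.ratio t| * enorm x
    <= r * `|ln (Defs.ratio s) - ln (Defs.ratio t)|.
  by rewrite mulrC ler_pM ?enorm_ge0// dist_le_dist_ln.
have h2 : Defs.ratio t * enorm ((rotation s - rotation t) *m x)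
    <= r * opnorm (rotation s - rotation t).
  apply: le_trans (_ : enorm ((rotation s - rotation t) *m x) <= _).
    by rewrite ler_piMl ?enorm_ge0.
  apply: le_trans (enorm_mulmx _ _) _.
  by rewrite mulrC ler_wpM2r ?opnorm_ge0.
have h3 := enorm_ge0 (translation s - translation t).
have h4 := opnorm_ge0 (rotation s - rotation t).
have h5 := normr_ge0 (ln (Defs.ratio s) - ln (Defs.ratio t)).
rewrite /sim_dist.
move: (enorm _) (opnorm _) (`|ln _ - _|) h1 h2 h3 h4 h5 => a b l *.
nra.
Qed.

End Contractions.

Theorem theorem3p6 (R : realType) (m N : nat)
    (c : 'I_N -> R) (U : 'I_N -> 'M[R]_m) (a : 'I_N -> 'cV[R]_m)
    (A : set 'cV[R]_m)
    (hm : (1 <= m)%N) (hN : (2 <= N)%N)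
    (hc : forall i, 0 < c i < 1)
    (hU : forall i, orthogonal_mx (U i))
    (hA : is_attractor (fun i => Sim (c i) (U i) (a i)) A) :
  exists k : R, forall n : nat,
    Delta_star (fun i => Sim (c i) (U i) (a i)) A n
      <= k * Delta (fun i => Sim (c i) (U i) (a i)) n.
Proof.
set h := fun i => Sim (c i) (U i) (a i).
have hsim i : nonexpansive (h i).
  by split => //=; have /andP[-> /ltW ->] := hc i.
have [[x Ax] Aco _] := hA.
have [r r0 coA] := closed_convex_hull_bounded Aco.
have coA0 : closed_convex_hull A !=set0 by exists x => B [_]; exact.
exists (r + 1) => n; rewrite /Delta_star /Delta.
(* Without pairs of distinct words, as for [n = 0], both infima are 0 by default. *)
have [->|P0] := eqVneq [set ij : n.-tuple 'I_N * n.-tuple 'I_N | ij.1 != ij.2]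
  set0; first by rewrite !image_set0 !inf0 mulr0.
have k0 : 0 < r + 1 by rewrite ltr_wpDl.
(* Dividing by [r + 1] reduces the claim to a lower bound for the set of distances [sim_dist],
   checked pair by pair. *)
rewrite mulrC -ler_pdivrMr//; apply: lb_le_inf.
  by apply/image_nonempty/set0P.
move=> _ [ij ijP <-]; rewrite ler_pdivrMr//.
apply: (@le_trans _ _ (hausdorff_dist
    (sim_map (sim_word h ij.1) @` closed_convex_hull A)
    (sim_map (sim_word h ij.2) @` closed_convex_hull A))).
  apply: ge_inf; last by exists ij.
  by exists 0 => _ [? _ <-]; exact: hausdorff_dist_ge0.
apply: hausdorff_dist_image_le => // y /coA yr.
by rewrite mulrC; apply: enorm_sim_map_sub_le => //; exact: nonexpansive_word.
Qed.
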